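(* Let $B^n \subset \mathbb{R}^n$ denote the unit ball. For any $\ell \in \mathbb{N}$ there exists $n_0 \in \mathbb{N}$ such that $N(B^n) \geq n^\ell$ for all $n \geq n_0$.
   Context: For a bounded domain $\Omega \subset \mathbb{R}^n$ with sufficiently smooth boundary, let $0 < \lambda_1 < \lambda_2 \leq \cdots$ be the Dirichlet eigenvalues and $0 = \mu_1 < \mu_2 \leq \mu_3 \leq \cdots$ the Neumann eigenvalues of $-\Delta$ on $\Omega$, each repeated according to multiplicity. Define $$N(\Omega) = \#\{k \in \mathbb{N} : \mu_k \leq \lambda_1\},$$ where $\mathbb{N} = \{1,2,3,\ldots\}$. *)

(* Defs.v *)
From HB Require Import structures.
From mathcomp Require Import all_boot all_order all_algebra.
From mathcomp Require Import all_classical all_reals all_analysis.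

Set Implicit Arguments.
Unset Strict Implicit.
Unset Printing Implicit Defensive.

Import Order.TTheory GRing.Theory Num.Theory.
Import numFieldNormedType.Exports.

Local Open Scope classical_set_scope.
Local Open Scope ring_scope.

Section DirichletNeumann.
Context {R : realType} {n : nat}.

Implicit Types (x v d : 'rV[R]_n) (u : 'rV[R]_n -> R) (Omega : set 'rV[R]_n).

Definition dotp x v : R := \sum_(i < n) x 0 i * v 0 i.

(* The norm of the library on 'rV[R]_n is the sup norm, hence the explicit
   Euclidean inequality. *)
Definition unit_ball : set 'rV[R]_n := [set x | dotp x x < 1].

Definition basis_vec (i : 'I_n) : 'rV[R]_n := delta_mx 0 i.

Definition partial (i : 'I_n) u : 'rV[R]_n -> R := fun x => 'D_(basis_vec i) u x.

Definition laplacian u : 'rV[R]_n -> R :=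
  fun x => \sum_(i < n) partial i (partial i u) x.

(* u is C^2 on the open set Omega *)
Definition C2_on Omega u : Prop := forall x, Omega x ->
  [/\ {for x, continuous u},
      forall i, derivable u x (basis_vec i) /\ {for x, continuous (partial i u)} &
      forall i j, derivable (partial i u) x (basis_vec j) /\
                  {for x, continuous (partial j (partial i u))}].

Definition boundary Omega : set 'rV[R]_n := closure Omega `\` interior Omega.

(* When the boundary of Omega is C^1, this holds for exactly one v at each
   boundary point x, the outward unit normal: directions making an obtuse
   (acute) angle with v point into (out of) Omega. *)
Definition outward_normal Omega x v : Prop :=
  [/\ dotp v v = 1,
      forall d, dotp d v < 0 -> \forall t \near 0^'+, Omega (x + t *: d) &
      forall d, 0 < dotp d v -> \forall t \near 0^'+, ~ Omega (x + t *: d)].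

(* Classical solutions in C^2(Omega) and C^0(closure Omega). Functions are
   defined on the whole space, but only their values on the closure of Omega
   matter. *)
Definition dirichlet_eigenspace Omega (lambda : R) : set ('rV[R]_n -> R) :=
  [set u | [/\ C2_on Omega u,
               {within closure Omega, continuous u},
               forall x, Omega x -> - laplacian u x = lambda * u x &
               forall x, boundary Omega x -> u x = 0]].

(* Classical solutions in C^2(Omega) and C^1(closure Omega): g is the
   continuous extension of the gradient of u to the closure of Omega. *)
Definition neumann_eigenspace Omega (mu : R) : set ('rV[R]_n -> R) :=
  [set u | [/\ C2_on Omega u,
               {within closure Omega, continuous u},
               forall x, Omega x -> - laplacian u x = mu * u x &
               exists g : 'I_n -> 'rV[R]_n -> R,
                 [/\ forall i, {within closure Omega, continuous (g i)},
                     forall i x, Omega x -> g i x = partial i u x &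
                     forall x v, boundary Omega x -> outward_normal Omega x v ->
                       \sum_(i < n) g i x * v 0 i = 0]]].

(* Linear independence of the restrictions to Omega. *)
Definition lin_indep_on Omega (m : nat) (f : 'I_m -> 'rV[R]_n -> R) : Prop :=
  forall c : 'I_m -> R,
    (forall x, Omega x -> \sum_(i < m) c i * f i x = 0) -> forall i, c i = 0.

(* Dimension, possibly +oo, of the space of restrictions to Omega of the
   functions of E. *)
Definition dim_on Omega (E : set ('rV[R]_n -> R)) : \bar R :=
  ereal_sup [set (m%:R)%:E | m in [set m : nat |
    exists f : 'I_m -> 'rV[R]_n -> R,
      (forall i, E (f i)) /\ lin_indep_on Omega f]].

(* Number, with multiplicity, of the eigenvalues that are at most t; the
   numbers that are not eigenvalues have a null eigenspace and contribute 0. *)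
Definition eigen_count Omega (E : R -> set ('rV[R]_n -> R)) (t : R) : \bar R :=
  \esum_(s in [set s : R | s <= t]) dim_on Omega (E s).

(* The k-th eigenvalue, k = 1, 2, ..., in nondecreasing order and repeated
   according to multiplicity; +oo if there are fewer than k eigenvalues. *)
Definition eigen_seq Omega (E : R -> set ('rV[R]_n -> R)) (k : nat) : \bar R :=
  ereal_inf [set t%:E | t in
    [set t : R | ((k%:R)%:E <= eigen_count Omega E t)%E]].

Definition dirichlet_eigenvalue Omega : nat -> \bar R :=
  eigen_seq Omega (dirichlet_eigenspace Omega).

Definition neumann_eigenvalue Omega : nat -> \bar R :=
  eigen_seq Omega (neumann_eigenspace Omega).

Definition N_count Omega : \bar R :=
  counting [set k : nat | (0 < k)%N /\
    (neumann_eigenvalue Omega k <= dirichlet_eigenvalue Omega 1%N)%E].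

End DirichletNeumann.

Arguments unit_ball R n : clear implicits.

(* Main.v *)
Require Import Defs.
From mathcomp Require Import all_boot all_order all_algebra.
From mathcomp Require Import all_classical all_reals all_analysis.
From mathcomp Require Import ring lra zify.
Import Order.TTheory GRing.Theory Num.Theory.
Import numFieldNormedType.Exports.
Local Open Scope classical_set_scope.
Local Open Scope ring_scope.

(* Let k = 2 l and L = k (n + 2 k).  Barta's argument with the Gaussian
   exp (- k |x|^2) shows that no Dirichlet eigenvalue of the ball is below
   2 n k - 4 k^2, which exceeds L for n large.  If h is a homogeneous harmonic
   polynomial of degree k, then h(x) F(mu |x|^2) is a Neumann eigenfunction for
   mu, where F is a Bessel-type entire function and mu is a root of
   k F + 2 z F'; there is such a root in [0, L], L being the Rayleigh quotient
   of h.  The squarefree monomials of degree k are harmonic and independent,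
   which gives multiplicity at least 'C(n, k) >= n ^ l. *)

(** * Bessel-type series *)

Section BesselSeries.
Context {R : realType}.
Implicit Types (c z x M : R) (m : nat).

(** Neither a variational principle nor discreteness of the spectrum is invoked. As [eigen_seq] is
    an infimum over counts of dimensions, bounding the first Dirichlet eigenvalue from below only
    asks that the eigenspaces under the bound be trivial, and bounding the first m Neumann
    eigenvalues from above only asks for m independent eigenfunctions of a single mu. The degree is
    2 l rather than l because 'C(n, k) is about n ^ k / k!: half of the exponent absorbs the
    factorial. Both bounds are linear in n, with slopes k and 2 k, so the Gaussian parameter can
    stay fixed while n grows. *)

Definition bcoef c m : R :=
  (-1) ^+ m / (4 ^+ m * m`!%:R * \prod_(i < m) (c + i%:R)).

(* Up to the constant Gamma c, this is (sqrt z / 2) ^ (1 - c) J_(c - 1) (sqrt z),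
   the solution of 4 z F'' + 4 c F' + F = 0 with F 0 = 1. *)
Definition bessel c z : R := limn (pseries (bcoef c) z).

Lemma rising_prod_ge1 c m : 1 <= c -> 1 <= \prod_(i < m) (c + i%:R).
Proof.
move=> c1; elim: m => [|m IH]; first by rewrite big_ord0.
rewrite big_ord_recr /= -[leLHS]mulr1 ler_pM //.
by rewrite (le_trans c1) // lerDl.
Qed.

(** For c >= 1 the factors 4 and c + i in the denominators are at least 1, so the exponential series
    of [|z|] dominates. *)
Lemma is_cvg_bessel c z : 1 <= c -> cvgn (pseries (bcoef c) z).
Proof.
move=> c1; apply: normed_cvg.
apply: series_le_cvg (@is_cvg_series_exp_coeff R `|z|) => //= m.
  by rewrite /exp_coeff /= divr_ge0.
have P1 := rising_prod_ge1 c m c1.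
have P0 := lt_le_trans ltr01 P1.
have f0 : 0 < m`!%:R :> R by rewrite ltr0n fact_gt0.
have q0 : 1 <= 4 ^+ m :> R by rewrite exprn_ege1 // ler1n.
have q1 := lt_le_trans ltr01 q0.
rewrite /bcoef /exp_coeff /= !normrM normrX normrN1 expr1n mul1r normrX mulrC.
rewrite ler_wpM2l ?exprn_ge0 // normfV !normrM !gtr0_norm // lef_pV2 ?posrE ?mulr_gt0 //.
by rewrite mulrAC ler_peMl ?(ltW f0) // -[leLHS]mulr1 ler_pM.
Qed.

(** Termwise differentiation only raises the parameter: m + 1 cancels in (m + 1)! and the first
    factor c leaves the rising product. Hence every derivative stays in the family [bessel]. *)
Lemma pseries_diffs_bcoef c : 1 <= c ->
  pseries_diffs (bcoef c) = (fun m => - (4 * c)^-1 * bcoef (c + 1) m).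
Proof.
move=> c1; have c0 := lt_le_trans ltr01 c1.
apply/funext => m; rewrite /pseries_diffs /bcoef big_ord_recl /= addr0.
under eq_bigr do rewrite /bump /= natrD addrA.
have P1 := rising_prod_ge1 (c + 1) m.
have /P1 {}P1 : 1 <= c + 1 by rewrite ler_wpDr.
have P0 := lt_le_trans ltr01 P1.
rewrite factS natrM !exprS.
have q1 : 4 ^+ m != 0 :> R by rewrite expf_neq0 // pnatr_eq0.
have f0 : m`!%:R != 0 :> R by rewrite pnatr_eq0 -lt0n fact_gt0.
field.
by rewrite q1 f0 (gt_eqF P0) (gt_eqF c0) /= nat1r pnatr_eq0.
Qed.

Lemma pseriesZ (f : nat -> R) k z :
  pseries (fun m => k * f m) z = (fun n => k * pseries f z n).
Proof.
apply/funext => n; rewrite /pseries /series /= mulr_sumr.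
by apply: eq_bigr => i _; rewrite mulrA.
Qed.

Lemma is_derive_bessel c z : 1 <= c ->
  is_derive z 1 (bessel c) (- (4 * c)^-1 * bessel (c + 1) z).
Proof.
move=> c1.
have c11 : 1 <= c + 1 by rewrite ler_wpDr.
have c21 : 1 <= c + 1 + 1 by rewrite ler_wpDr.
have E : limn (pseries (pseries_diffs (bcoef c)) z)
       = - (4 * c)^-1 * bessel (c + 1) z.
  rewrite pseries_diffs_bcoef // pseriesZ.
  by apply/cvg_lim => //; apply: cvgMr; exact: is_cvg_bessel.
(* Termwise differentiation requires convergence of the series and of its first two formal
   derivatives at a point of modulus above [|z|]. *)
rewrite -E; apply: (@pseries_snd_diffs _ _ (`|z| + 1)).
- exact: is_cvg_bessel.
- rewrite pseries_diffs_bcoef // pseriesZ.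
  by apply: is_cvgMr; exact: is_cvg_bessel.
- rewrite pseries_diffs_bcoef //.
  have -> : pseries_diffs (fun m : nat => - (4 * c)^-1 * bcoef (c + 1) m)
     = (fun m => - (4 * c)^-1 * pseries_diffs (bcoef (c + 1)) m).
    by apply/funext => m; rewrite /pseries_diffs mulrCA.
  rewrite pseries_diffs_bcoef // 2!pseriesZ.
  by apply: is_cvgMr; apply: is_cvgMr; exact: is_cvg_bessel.
- by rewrite [ltRHS]ger0_norm ?addr_ge0 // ltrDl.
Qed.

Lemma continuous_bessel c : 1 <= c -> continuous (bessel c).
Proof.
move=> c1 z; apply/differentiable_continuous/derivable1_diffP.
by have [] := is_derive_bessel c z c1.
Qed.

Lemma bessel0 c : 1 <= c -> bessel c 0 = 1.
Proof.
move=> c1; apply/cvg_lim => //; rewrite -(cvg_shiftS _) /=.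
apply: cvg_near_cst; near=> n.
rewrite /pseries /series /= big_nat_recl // big1 ?addr0.
  by rewrite /bcoef big_ord0 fact0 !expr0 !mulr1 divr1.
by move=> i _; rewrite expr0n mulr0.
Unshelve. all: by end_near. Qed.

(** Coefficient form of [bessel_rec]: multiplication by m is the operator z d/dz, and the rising
    products from c and from c + 1 differ by the factor (c + m) / c. *)
Lemma bcoef_shift c m : 1 <= c ->
  (m%:R + c) * bcoef (c + 1) m = c * bcoef c m.
Proof.
move=> c1; have c0 := lt_le_trans ltr01 c1.
have E : c * \prod_(i < m) (c + 1 + i%:R) = \prod_(i < m) (c + i%:R) * (c + m%:R).
  transitivity (\prod_(i < m.+1) (c + i%:R)); last by rewrite big_ord_recr.
  rewrite big_ord_recl /= addr0; congr (_ * _).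
  by apply: eq_bigr => i _; rewrite /bump /= natrD addrA.
have c11 : 1 <= c + 1 by rewrite ler_wpDr.
have P1 := lt_le_trans ltr01 (rising_prod_ge1 (c + 1) m c11).
have P0 := lt_le_trans ltr01 (rising_prod_ge1 c m c1).
have q1 : 4 ^+ m != 0 :> R by rewrite expf_neq0 // pnatr_eq0.
have f0 : m`!%:R != 0 :> R by rewrite pnatr_eq0 -lt0n fact_gt0.
have cm : c + m%:R != 0 by rewrite gt_eqF // ltr_wpDr.
rewrite /bcoef; have -> : \prod_(i < m) (c + i%:R) =
    c * \prod_(i < m) (c + 1 + i%:R) / (c + m%:R).
  by rewrite E mulfK.
field.
by rewrite q1 f0 cm (gt_eqF P1) (gt_eqF c0).
Qed.

(* The differential equation, with F' and F'' expressed by bessel (c + 1) and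
   bessel (c + 1 + 1). *)
Lemma bessel_rec c z : 1 <= c ->
  z * (- (4 * (c + 1))^-1 * bessel (c + 1 + 1) z) + c * bessel (c + 1) z
  = c * bessel c z.
Proof.
move=> c1.
have c11 : 1 <= c + 1 by rewrite ler_wpDr.
have c21 : 1 <= c + 1 + 1 by rewrite ler_wpDr.
have cv : cvgn (pseries (pseries_diffs (bcoef (c + 1))) z).
  rewrite pseries_diffs_bcoef // pseriesZ.
  by apply: is_cvgMr; exact: is_cvg_bessel.
have E : limn (pseries (pseries_diffs (bcoef (c + 1))) z)
       = - (4 * (c + 1))^-1 * bessel (c + 1 + 1) z.
  rewrite pseries_diffs_bcoef // pseriesZ.
  by apply/cvg_lim => //; apply: cvgMr; exact: is_cvg_bessel.
have H := pseries_diffs_equiv cv.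
rewrite /= E in H.
have H1 : (fun n => z * series (fun i => i%:R * bcoef (c + 1) i * z ^+ i.-1) n +
     c * pseries (bcoef (c + 1)) z n) @ \oo -->
   z * (- (4 * (c + 1))^-1 * bessel (c + 1 + 1) z) + c * bessel (c + 1) z.
  by apply: cvgD; apply: cvgMr => //; exact: is_cvg_bessel.
have H2 : (fun n => c * pseries (bcoef c) z n) @ \oo --> c * bessel c z.
  by apply: cvgMr; exact: is_cvg_bessel.
have EE : (fun n => z * series (fun i => i%:R * bcoef (c + 1) i * z ^+ i.-1) n +
     c * pseries (bcoef (c + 1)) z n) = (fun n => c * pseries (bcoef c) z n).
  apply/funext => n; rewrite /pseries /series /= !mulr_sumr -big_split /=.
  apply: eq_bigr => i _; rewrite [RHS]mulrA -bcoef_shift //.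
  (* At i = 0 the exponent [i.-1] is 0 rather than -1, but the factor i kills that term. *)
  by case: i => [|i] /=; rewrite ?exprS; ring.
rewrite EE in H1.
exact: (cvg_unique _ H1 H2).
Qed.

(* At a minimum of Y on [0, M] either z = 0 or Y' <= 0, so z Y' <= 0 there. *)
Lemma radial_positivity (Y Y' : R -> R) (b M : R) : 0 < b -> 0 <= M ->
  (forall z, is_derive z 1 Y (Y' z)) ->
  (forall z, 0 <= z <= M -> 0 < z * Y' z + b * Y z) ->
  forall z, 0 <= z <= M -> 0 < Y z.
Proof.
move=> b0 M0 dY H.
have cY : {within `[0, M], continuous Y}.
  apply: continuous_subspaceT => z.
  by apply/differentiable_continuous/derivable1_diffP; have [] := dY z.
have [m] := EVT_min M0 cY.
rewrite in_itv /= => /[dup] mM /andP[m0 mleM] minm.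
suff Ym : 0 < Y m by move=> z zM; apply: lt_le_trans Ym (minm _ _); rewrite in_itv.
suff : m * Y' m <= 0.
  move=> mY; have := H m mM; have := pmulr_rgt0 (Y m) b0; lra.
have [->|mN0] := eqVneq m 0; first by rewrite mul0r.
have {mN0}m0 : 0 < m by rewrite lt_neqAle eq_sym mN0.
rewrite pmulr_rle0 // leNgt; apply/negP => Y'0.
have [dm vm] := dY m.
have cv : h^-1 *: (Y (h *: 1 + m) - Y m) @[h --> 0^'] --> Y' m.
  by rewrite -vm; exact: dm.
have /cvgrPdist_lt /(_ _ Y'0) := cv.
move=> /nbhs_ballP [e /= e0 He].
(* A step to the left: m + h stays in [[0, M]], and h is within the radius on which the difference
   quotient is positive. *)
pose h := - (Num.min (e / 2) m).
have h0 : h < 0 by rewrite oppr_lt0 lt_min divr_gt0.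
have : ball 0 e h.
  rewrite /ball /= sub0r normrN normrN gtr0_norm ?lt_min ?divr_gt0 ?m0 //.
  by rewrite gt_min; apply/orP; left; lra.
move=> /He /(_ (ltr0_neq0 h0)).
have : Y m <= Y (h *: 1 + m).
  apply: minm; rewrite in_itv /= /GRing.scale /= mulr1.
  have : Num.min (e / 2) m <= m by rewrite ge_min lexx orbT.
  rewrite -[Num.min _ _]opprK -/h => hm; apply/andP; split; lra.
rewrite -subr_ge0 => Yh.
have : h^-1 *: (Y (h *: 1 + m) - Y m) <= 0.
  by rewrite /GRing.scale /= nmulr_rle0 ?invr_lt0.
move=> le0; rewrite ger0_norm; last by lra.
lra.
Qed.

(* Without a root up to 2 c k, bessel c, bessel (c + 1) and bessel (c + 1 + 1)
   would be positive there, hence F = bessel c would satisfy F' <= - F / (4 c),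
   which makes k F + 2 z F' nonpositive at z = 2 c k. *)
Lemma neumann_root c (k : R) : 1 <= c -> 0 < k ->
  exists2 z : R, 0 <= z <= 2 * c * k &
    k * bessel c z + 2 * z * (- (4 * c)^-1 * bessel (c + 1) z) = 0.
Proof.
move=> c1 k0; have c0 := lt_le_trans ltr01 c1.
have c11 : 1 <= c + 1 by rewrite ler_wpDr.
have c21 : 1 <= c + 1 + 1 by rewrite ler_wpDr.
set G := fun z => k * bessel c z + 2 * z * (- (4 * c)^-1 * bessel (c + 1) z).
set M := 2 * c * k.
have M0 : 0 < M by rewrite !mulr_gt0.
apply: contrapT => NG.
have cG : continuous G.
  move=> z; apply: cvgD.
    by apply: cvgMr; exact: continuous_bessel.
  apply: cvgM; first by apply: cvgMr.
  by apply: cvgMr; exact: continuous_bessel.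
have G0 : G 0 = k by rewrite /G mulr0 mul0r addr0 bessel0 // mulr1.
have Gpos z : 0 <= z <= M -> 0 < G z.
  move=> /andP[z0 zM]; rewrite ltNge; apply/negP => Gz.
  have [||w] := @IVT R G 0 z 0 z0.
  - exact: continuous_subspaceT.
  - by rewrite G0 ge_min Gz orbT /= le_max ltW.
  rewrite in_itv /= => /andP[w0 wz] Gw; apply: NG; exists w => //.
  by rewrite w0 (le_trans wz).
have J0 z : 0 <= z <= M -> 0 < bessel c z.
  apply: (@radial_positivity _ (fun z => - (4 * c)^-1 * bessel (c + 1) z) (k / 2));
    rewrite ?divr_gt0 ?(ltW M0) // => {}z; first exact: is_derive_bessel.
  move=> /Gpos; rewrite /G.
  by set a := bessel c z; set b := - _ * _; lra.
(* For Y = [bessel (c + 1)], [bessel_rec] evaluates z Y' + c Y as c times [bessel c z], so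
   positivity passes from each parameter to the next. *)
have J1 z : 0 <= z <= M -> 0 < bessel (c + 1) z.
  apply: (@radial_positivity _
    (fun z => - (4 * (c + 1))^-1 * bessel (c + 1 + 1) z) c);
    rewrite ?(ltW M0) // => {}z; first exact: is_derive_bessel.
  by move=> /J0 ?; rewrite bessel_rec // mulr_gt0.
have c10 := lt_le_trans ltr01 c11.
have J2 z : 0 <= z <= M -> 0 < bessel (c + 1 + 1) z.
  apply: (@radial_positivity _
    (fun z => - (4 * (c + 1 + 1))^-1 * bessel (c + 1 + 1 + 1) z) (c + 1));
    rewrite ?(ltW M0) // => {}z; first exact: is_derive_bessel.
  by move=> /J1 ?; rewrite bessel_rec // mulr_gt0.
have MM : 0 <= M <= M by rewrite lexx ltW.
have := Gpos M MM; rewrite /G.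
(* The endpoint 2 c k is chosen for this: there G is k times [bessel c M - bessel (c + 1) M], which
   [bessel_rec] makes nonpositive once [bessel (c + 1 + 1) M] is positive. *)
have -> : 2 * M * (- (4 * c)^-1 * bessel (c + 1) M) = - k * bessel (c + 1) M.
  by rewrite /M; field; rewrite gt_eqF.
apply/negP; rewrite -leNgt mulNr subr_le0 ler_pM2l //.
rewrite -(ler_pM2l c0) -bessel_rec // gerDr.
rewrite mulNr mulrN oppr_le0.
by rewrite !mulr_ge0 ?invr_ge0 ?(ltW M0) ?mulr_ge0 ?(ltW c10) // ltW // J2.
Qed.

End BesselSeries.

(** * Calculus of radial functions *)

Section DirectionalDerivatives.
Context {R : realType} {V : normedModType R}.

(** Directional derivatives become one-variable derivatives along a line; t is arbitrary so that
    one-variable theorems apply on a whole interval. *)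
Lemma is_derive_line (f : V -> R) (x v : V) (t d : R) :
  is_derive (t *: v + x) v f d <-> is_derive t 1 (fun h => f (h *: v + x)) d.
Proof.
have E : (fun h : R => h^-1 *: (f (h *: v + (t *: v + x)) - f (t *: v + x))) =
   (fun h : R => h^-1 *: ((fun h => f (h *: v + x)) (h *: 1 + t) - f (t *: v + x))).
  by apply/funext => h; rewrite addrA -scalerDl [h *: 1]mulr1.
split=> -[]; rewrite /derivable /derive /= => dr dv; split.
- by rewrite /derivable -E.
- by rewrite /derive -E.
- by rewrite /derivable E.
- by rewrite /derive E.
Qed.

Lemma is_derive_comp_line (f : V -> R) (g : R -> R) (x v : V) (df dg : R) :
  is_derive x v f df -> is_derive (f x) 1 g dg ->
  is_derive x v (fun y => g (f y)) (dg * df).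
Proof.
rewrite -[x]add0r -[0](scale0r v) => /is_derive_line df' dg'.
by apply/is_derive_line; exact: is_derive1_comp.
Qed.

(** If d > 0, the restriction g of f to the line has g' = 0 at the maximum and g' > 0 just to its
    right, so the mean value theorem makes g exceed its maximum. *)
Lemma second_derivative_at_max (f f' : V -> R) (x v : V) (d : R) :
  (\forall y \near x, is_derive y v f (f' y)) -> is_derive x v f' d ->
  (\forall y \near x, f y <= f x) -> d <= 0.
Proof.
move=> df df' fmax.
pose g h := f (h *: v + x); pose g' h := f' (h *: v + x).
have cl : (fun h : R => h *: v + x) @ 0 --> x.
  rewrite -[X in _ --> X]add0r -[0 in X in _ --> X](scale0r v).
  by apply: cvgD; [exact: cvgZr_tmp|exact: cvg_cst].
have dg : \forall h \near (0 : R), is_derive (h : R) 1 g (g' h).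
  by near=> h; apply/is_derive_line; near: h; exact: (cl _ df).
have gm : \forall h \near (0 : R), g h <= g 0.
  by near=> h; rewrite /g scale0r add0r; near: h; exact: (cl _ fmax).
have dg' : is_derive (0 : R) 1 g' d.
  by apply/is_derive_line; rewrite scale0r add0r.
have [e e0 He] : exists2 e : R, 0 < e & forall h : R, `|h| < e ->
    is_derive (h : R) 1 g (g' h) /\ g h <= g 0.
  have [/= e e0 He] := (nbhs_ballP _ _).1 (filterI dg gm).
  by exists e => // h he; apply: He; rewrite /ball /= sub0r normrN.
have g'0 : g' 0 = 0.
  have e20 : 0 < e / 2 by rewrite divr_gt0.
  have abs t : t \in `](- (e / 2)), (e / 2)[%R -> `|t| < e.
    by rewrite in_itv /= ltr_norml => /andP[? ?]; apply/andP; split; lra.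
  have [||||] := @derive1_at_max R g (- (e / 2)) (e / 2) 0.
  - by lra.
  - by move=> t /abs /He [[]].
  - by rewrite in_itv /=; apply/andP; split; lra.
  - by move=> t /abs /He [_].
  - move=> _ D0; have [|[_ D0'] _] := He 0; first by rewrite normr0.
    by rewrite -D0' D0.
rewrite leNgt; apply/negP => d0.
have [dm vm] := dg'.
have cv : h^-1 *: (g' (h *: 1 + 0) - g' 0) @[h --> 0^'] --> d.
  by rewrite -vm; exact: dm.
have /cvgrPdist_lt /(_ _ d0) := cv.
move=> /nbhs_ballP [r /= r0 Hr].
have g'pos h : 0 < h -> h < r -> 0 < g' h.
  move=> h0 hr.
  have : ball 0 r h by rewrite /ball /= sub0r normrN gtr0_norm.
  move=> /Hr /(_ (lt0r_neq0 h0)).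
  rewrite g'0 subr0 addr0 [h *: 1]mulr1 => H.
  have : 0 < h^-1 *: g' h.
    by move: H; rewrite ltr_norml => /andP[_]; rewrite ltrBlDr ltrDl.
  by rewrite /GRing.scale /= pmulr_rgt0 // invr_gt0.
pose b := Num.min e r / 2.
have m0 : 0 < Num.min e r by rewrite lt_min e0.
have b0 : 0 < b by rewrite divr_gt0.
have be : b < e.
  by apply: lt_le_trans (_ : Num.min e r <= _); [rewrite /b; lra|rewrite ge_min lexx].
have br : b < r.
  apply: lt_le_trans (_ : Num.min e r <= _); first by rewrite /b; lra.
  by rewrite ge_min lexx orbT.
have inb h : 0 <= h <= b -> `|h| < e.
  by move=> /andP[h0 hb]; rewrite ger0_norm // (le_lt_trans hb).
have [h||c] := @MVT R g g' 0 b b0.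
- rewrite in_itv /= => /andP[h0 hb]; have [|//] := He h.
  by apply: inb; rewrite !ltW.
- apply: derivable_within_continuous => h'; rewrite in_itv /= => /inb.
  by move=> /He [[]].
- rewrite in_itv /= => /andP[c0 cb] E.
  have : 0 < g b - g 0.
    by rewrite E subr0 mulr_gt0 // g'pos // (lt_trans cb).
  have [|_] := He b; first by rewrite inb // lexx ltW.
  by rewrite subr_gt0 leNgt => /negP.
Unshelve. all: by end_near. Qed.

End DirectionalDerivatives.

Section RadialProducts.
Context {R : realType} {n : nat}.
Implicit Types (x v : 'rV[R]_n) (u h : 'rV[R]_n -> R).

Lemma is_derive_coord x v (i : 'I_n) :
  is_derive x v (fun y : 'rV[R]_n => y 0 i) (v 0 i).
Proof.
rewrite -[x]add0r -[0](scale0r v); apply/is_derive_line.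
have -> : (fun h : R => (h *: v + x) 0 i) = v 0 i *: (id : R -> R) + cst (x 0 i).
  apply/funext => h; change ((h *: v + x) 0 i = v 0 i * h + x 0 i).
  by rewrite !mxE mulrC.
have H := is_deriveD (is_deriveZ (v 0 i) (is_derive_id (0 : R) 1))
  (is_derive_cst (x 0 i) (0 : R) 1).
by apply: (is_derive_eq H); rewrite addr0 [LHS]mulr1.
Qed.

Lemma basis_vecE (i j : 'I_n) : (basis_vec i : 'rV[R]_n) 0 j = (j == i)%:R.
Proof. by rewrite /basis_vec mxE eqxx. Qed.

Lemma is_derive_dotp x (i : 'I_n) :
  is_derive x (basis_vec i) (fun y => dotp y y) (2 * x 0 i).
Proof.
have -> : (fun y : 'rV[R]_n => dotp y y) =
    \sum_(k < n) ((fun y : 'rV[R]_n => y 0 k) * (fun y => y 0 k)).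
  by apply/funext => y; rewrite /dotp fct_sumE.
apply: is_derive_eq.
  by apply: is_derive_sum => k; apply: is_deriveM; exact: is_derive_coord.
rewrite (bigD1 i) //= big1 => [|k ki].
  by rewrite addr0 basis_vecE eqxx /GRing.scale /= mulr1 mulr2n mulrDl mul1r.
by rewrite basis_vecE (negbTE ki) scaler0 addr0.
Qed.

Lemma continuous_dotp : continuous (fun x : 'rV[R]_n => dotp x x).
Proof.
move=> x; rewrite /dotp.
have -> : (fun y : 'rV[R]_n => \sum_(k < n) y 0 k * y 0 k) =
    \sum_(k < n) ((fun y : 'rV[R]_n => y 0 k) * (fun y => y 0 k)).
  by apply/funext => y; rewrite fct_sumE.
elim/big_ind : _ => [|f g cf cg|k _]; first exact: cst_continuous.
  exact: continuousD.
by apply: continuousM; exact: coord_continuous.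
Qed.

Lemma partialE u (du : 'I_n -> 'rV[R]_n -> R) :
  (forall i x, is_derive x (basis_vec i) u (du i x)) ->
  forall i, partial i u = du i.
Proof. by move=> d i; apply/funext => x; have [] := d i x. Qed.

Lemma C2_on_derive (Omega : set 'rV[R]_n) u (du : 'I_n -> 'rV[R]_n -> R)
    (ddu : 'I_n -> 'I_n -> 'rV[R]_n -> R) :
  (forall i x, is_derive x (basis_vec i) u (du i x)) ->
  (forall i j x, is_derive x (basis_vec j) (du i) (ddu i j x)) ->
  continuous u -> (forall i, continuous (du i)) ->
  (forall i j, continuous (ddu i j)) -> C2_on Omega u.
Proof.
move=> d dd cu cdu cddu x _; have pE := partialE _ _ d.
split; first exact: cu.
  move=> i; rewrite pE; split; last exact: cdu.
  by have [] := d i x.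
move=> i j; rewrite pE (partialE _ _ (dd i)); split; last exact: cddu.
by have [] := dd i j x.
Qed.

Lemma laplacianE u (du : 'I_n -> 'rV[R]_n -> R)
    (ddu : 'I_n -> 'I_n -> 'rV[R]_n -> R) :
  (forall i x, is_derive x (basis_vec i) u (du i x)) ->
  (forall i j x, is_derive x (basis_vec j) (du i) (ddu i j x)) ->
  forall x, laplacian u x = \sum_(i < n) ddu i i x.
Proof.
move=> d dd x; apply: eq_bigr => i _.
by rewrite (partialE _ _ d) (partialE _ _ (dd i)).
Qed.

Section Radial.
Variables (h : 'rV[R]_n -> R) (dh : 'I_n -> 'rV[R]_n -> R).
Variables (f f' : R -> R).
Hypotheses (dhE : forall i x, is_derive x (basis_vec i) h (dh i x)).
Hypothesis (df : forall s : R, is_derive s 1 f (f' s)).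

Lemma is_derive_radial i x : is_derive x (basis_vec i)
  (fun y => h y * f (dotp y y))
  (dh i x * f (dotp x x) + h x * (2 * x 0 i * f' (dotp x x))).
Proof.
have H := is_derive_comp_line _ _ _ _ _ _ (is_derive_dotp x i) (df (dotp x x)).
apply: (is_derive_eq (is_deriveM (dhE i x) H)).
by rewrite /GRing.scale /= addrC [f _ * _]mulrC [f' _ * _]mulrC.
Qed.

End Radial.

Lemma continuous_radial h (f : R -> R) : continuous h -> continuous f ->
  continuous (fun x => h x * f (dotp x x)).
Proof.
move=> ch cf x; apply: continuousM; first exact: ch.
by apply: (@continuous_comp _ _ _ (fun y : 'rV[R]_n => dotp y y) f);
  [exact: continuous_dotp|exact: cf].
Qed.

Section Radial2.
Variables (h : 'rV[R]_n -> R) (dh : 'I_n -> 'rV[R]_n -> R).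
Variable (ddh : 'I_n -> 'I_n -> 'rV[R]_n -> R).
Variables (f f' f'' : R -> R).
Hypotheses (dhE : forall i x, is_derive x (basis_vec i) h (dh i x)).
Hypotheses (ddhE : forall i j x, is_derive x (basis_vec j) (dh i) (ddh i j x)).
Hypotheses (ch : continuous h) (cdh : forall i, continuous (dh i)).
Hypotheses (cddh : forall i j, continuous (ddh i j)).
Hypothesis (df : forall s : R, is_derive s 1 f (f' s)).
Hypothesis (df' : forall s : R, is_derive s 1 f' (f'' s)).
Hypothesis (cf'' : continuous f'').

(** The argument is |x|^2 instead of |x|, which keeps the product C^2 at the origin. It serves for
    the Gaussian (h = 1) and for the Neumann eigenfunctions (h a monomial). *)
Definition radial : 'rV[R]_n -> R := fun x => h x * f (dotp x x).

Definition radial_d (i : 'I_n) : 'rV[R]_n -> R := fun x =>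
  dh i x * f (dotp x x) + (2 * x 0 i * h x) * f' (dotp x x).

Definition radial_dd (i j : 'I_n) : 'rV[R]_n -> R := fun x =>
  ddh i j x * f (dotp x x) + (2 * x 0 j * dh i x) * f' (dotp x x) +
  ((2 * (i == j)%:R * h x + 2 * x 0 i * dh j x) * f' (dotp x x) +
   (2 * x 0 j * (2 * x 0 i * h x)) * f'' (dotp x x)).

Let cf : continuous f.
Proof.
by move=> s; apply/differentiable_continuous/derivable1_diffP; have [] := df s.
Qed.

Let cf' : continuous f'.
Proof.
by move=> s; apply/differentiable_continuous/derivable1_diffP; have [] := df' s.
Qed.

Lemma is_derive_radial_d i x :
  is_derive x (basis_vec i) radial (radial_d i x).
Proof.
apply: (is_derive_eq (is_derive_radial h dh f f' dhE df i x)).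
by rewrite /radial_d; ring.
Qed.

(** [radial_d i] is a sum of two products of the same shape, with [dh i] and 2 x_i h in the place of
    h; [is_derive_radial] applies to each. *)
Lemma is_derive_radial_dd i j x :
  is_derive x (basis_vec j) (radial_d i) (radial_dd i j x).
Proof.
have H1 := is_derive_radial (dh i) (ddh i) f f' (fun j x => ddhE i j x) df j x.
have dxh k y : is_derive y (basis_vec k) (fun y => 2 * y 0 i * h y)
    (2 * (i == k)%:R * h y + 2 * y 0 i * dh k y).
  have H := is_deriveZ 2 (is_deriveM (is_derive_coord y (basis_vec k) i) (dhE k y)).
  have -> : (fun y : 'rV[R]_n => 2 * y 0 i * h y) =
     (2 : R) *: ((fun y : 'rV[R]_n => y 0 i) * h).
    by apply/funext => z; rewrite -mulrA.
  apply: (is_derive_eq H).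
  by rewrite basis_vecE /GRing.scale /=; ring.
have H2 := is_derive_radial _ _ f' f'' dxh df' j x.
apply: (is_derive_eq (is_deriveD H1 H2)).
by rewrite /radial_dd; ring.
Qed.

Let c2 (i : 'I_n) : continuous (fun y : 'rV[R]_n => 2 * y 0 i).
Proof.
move=> x; apply: (@continuousM _ _ (cst 2) (fun y : 'rV[R]_n => y 0 i)).
  exact: cst_continuous.
exact: coord_continuous.
Qed.

Let cxh i : continuous (fun y : 'rV[R]_n => 2 * y 0 i * h y).
Proof.
move=> x; apply: (@continuousM _ _ (fun y : 'rV[R]_n => 2 * y 0 i) h).
  exact: c2.
exact: ch.
Qed.

Lemma continuous_radial_d i : continuous (radial_d i).
Proof.
have H1 := continuous_radial _ _ (cdh i) cf.
have H2 := continuous_radial _ _ (cxh i) cf'.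
by move=> x; apply: (continuousD (H1 x) (H2 x)).
Qed.

Lemma continuous_radial_dd i j : continuous (radial_dd i j).
Proof.
have H1 := continuous_radial _ _ (cddh i j) cf.
have c2dh k l : continuous (fun y : 'rV[R]_n => 2 * y 0 k * dh l y).
  by move=> y; apply: (continuousM (c2 k y) (cdh l y)).
have H2 := continuous_radial _ _ (c2dh j i) cf'.
have c3 : continuous (fun y : 'rV[R]_n =>
    2 * (i == j)%:R * h y + 2 * y 0 i * dh j y).
  move=> y; apply: (continuousD _ (c2dh i j y)).
  have cc : continuous (cst (2 * (i == j)%:R) : 'rV[R]_n -> R).
    exact: cst_continuous.
  by apply: (continuousM (cc y) (ch y)).
have H3 := continuous_radial _ _ c3 cf'.
have c4 : continuous (fun y : 'rV[R]_n => 2 * y 0 j * (2 * y 0 i * h y)).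
  by move=> y; apply: (continuousM (c2 j y) (cxh i y)).
have H4 := continuous_radial _ _ c4 cf''.
move=> x.
by apply: (continuousD (continuousD (H1 x) (H2 x)) (continuousD (H3 x) (H4 x))).
Qed.

Lemma C2_on_radial Omega : C2_on Omega radial.
Proof.
apply: (C2_on_derive _ _ radial_d radial_dd).
- exact: is_derive_radial_d.
- exact: is_derive_radial_dd.
- exact: continuous_radial.
- exact: continuous_radial_d.
- exact: continuous_radial_dd.
Qed.

(** The two sums are the Laplacian of h and the Euler operator on h: both vanish for h = 1, and they
    are 0 and k h for a squarefree monomial of degree k. *)
Lemma laplacian_radial x : laplacian radial x =
  (\sum_(i < n) ddh i i x) * f (dotp x x) +
  (4 * \sum_(i < n) x 0 i * dh i x) * f' (dotp x x) +
  h x * (2 * n%:R * f' (dotp x x) + 4 * dotp x x * f'' (dotp x x)).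
Proof.
rewrite (laplacianE _ _ _ is_derive_radial_d is_derive_radial_dd).
rewrite mulr_sumr 2!mulr_suml mulrDr.
have -> : h x * (2 * n%:R * f' (dotp x x)) =
    \sum_(i < n) h x * (2 * f' (dotp x x)).
  by rewrite sumr_const card_ord -mulr_natr; ring.
have -> : h x * (4 * dotp x x * f'' (dotp x x)) =
    \sum_(i < n) h x * (4 * (x 0 i * x 0 i) * f'' (dotp x x)).
  by rewrite -mulr_sumr -mulr_suml -mulr_sumr.
rewrite -!big_split /=; apply: eq_bigr => i _.
by rewrite /radial_dd eqxx mulr1n; ring.
Qed.

End Radial2.

End RadialProducts.

(** * Dirichlet eigenvalues of the ball *)

Section UnitBall.
Context {R : realType} {n : nat}.
Implicit Types (x v : 'rV[R]_n) (u : 'rV[R]_n -> R).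

Lemma open_unit_ball : open (unit_ball R n).
Proof.
rewrite (_ : unit_ball R n = (fun x => dotp x x) @^-1` [set t | t < 1]) //.
apply: open_comp; last exact: open_lt.
by move=> x _; exact: continuous_dotp.
Qed.

Lemma closure_unit_ball x : closure (unit_ball R n) x -> dotp x x <= 1.
Proof.
set S := (fun x : 'rV[R]_n => dotp x x) @^-1` [set t | t <= 1].
have C : closed S.
  apply: closed_comp; last exact: closed_le.
  by move=> y _; exact: continuous_dotp.
have BS : unit_ball R n `<=` S by move=> y; exact: ltW.
by move=> /(closureS BS) /C.
Qed.

Lemma boundary_unit_ball x : boundary (unit_ball R n) x -> dotp x x = 1.
Proof.
move=> [/closure_unit_ball le1 Nint]; apply/eqP; rewrite eq_le le1 leNgt /=.
by apply/negP => lt1; apply: Nint; exact: (open_nbhs_nbhs (conj open_unit_ball lt1)).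
Qed.

Lemma dotp_ge0 x : 0 <= dotp x x.
Proof. by apply: sumr_ge0 => i _; rewrite -expr2 sqr_ge0. Qed.

Lemma compact_closure_unit_ball : compact (closure (unit_ball R n)).
Proof.
apply: bounded_closed_compact; last exact: closed_closure.
exists 1; split=> // M M1 x /closure_unit_ball x1.
rewrite /= [leLHS]/Num.norm /= mx_normrE; apply: le_trans (ltW M1).
apply/bigmax_leP; split=> // -[i j] _; rewrite /= ord1.
rewrite -(@ler_pXn2r _ 2) ?nnegrE // expr1n real_normK ?num_real //.
apply: le_trans x1; rewrite /dotp (bigD1 j) //= expr2 lerDl.
by apply: sumr_ge0 => k _; rewrite -expr2 sqr_ge0.
Qed.

Section Gaussian.
Variable a : R.

Definition gaussian : 'rV[R]_n -> R :=
  radial (cst 1) (fun s => expR (- a * s)).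

Definition gaussian_d : 'I_n -> 'rV[R]_n -> R :=
  radial_d (cst 1) (fun _ => cst 0) (fun s => expR (- a * s))
    (fun s => - a * expR (- a * s)).

Definition gaussian_dd : 'I_n -> 'I_n -> 'rV[R]_n -> R :=
  radial_dd (cst 1) (fun _ => cst 0) (fun _ _ => cst 0)
    (fun s => expR (- a * s)) (fun s => - a * expR (- a * s))
    (fun s => a ^+ 2 * expR (- a * s)).

Lemma is_derive_expRM (b c s : R) :
  is_derive s 1 (fun s => c * expR (b * s)) (c * b * expR (b * s)).
Proof.
have H1 : is_derive s 1 (fun s : R => b * s) b.
  by apply: (is_derive_eq (is_deriveZ b (is_derive_id s 1))); rewrite [LHS]mulr1.
have H2 := is_derive_comp_line _ _ _ _ _ _ H1 (is_derive_expR (b * s)).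
by apply: (is_derive_eq (is_deriveZ c H2)); rewrite /GRing.scale /=; ring.
Qed.

Let df (s : R) : is_derive s 1 (fun s : R => expR (- a * s)) (- a * expR (- a * s)).
Proof.
have := is_derive_expRM (- a) 1 s; rewrite mul1r.
by under eq_fun do rewrite mul1r.
Qed.

Let df' (s : R) : is_derive s 1 (fun s : R => - a * expR (- a * s))
  (a ^+ 2 * expR (- a * s)).
Proof.
by apply: (is_derive_eq (is_derive_expRM (- a) (- a) s)); rewrite mulrNN -expr2.
Qed.

Let dcst (c : R) (i : 'I_n) x : is_derive x (basis_vec i) (cst c) (cst 0 x).
Proof. exact: is_derive_cst. Qed.

Lemma is_derive_gaussian i x : is_derive x (basis_vec i) gaussian (gaussian_d i x).
Proof. by apply: is_derive_radial_d => //; exact: dcst. Qed.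

Lemma is_derive_gaussian_d i j x :
  is_derive x (basis_vec j) (gaussian_d i) (gaussian_dd i j x).
Proof. by apply: is_derive_radial_dd => // *; exact: dcst. Qed.

(** On the ball |x|^2 < 1, so the bracket is at least 2 n a - 4 a ^ 2: this is the origin of the
    Dirichlet bound. *)
Lemma laplacian_gaussian x : \sum_(i < n) gaussian_dd i i x =
  - (2 * n%:R * a - 4 * a ^+ 2 * dotp x x) * expR (- a * dotp x x).
Proof.
have L := laplacian_radial (cst 1) (fun _ => cst 0) (fun _ _ => cst 0) _ _ _
  (fun i y => dcst 1 i y) (fun _ j y => dcst 0 j y) df df' x.
rewrite -(laplacianE _ _ _ is_derive_gaussian is_derive_gaussian_d).
rewrite [LHS]L /= big1 // mul0r big1 => [|i _]; last by rewrite mulr0.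
by ring.
Qed.

(* Barta's argument: the Gaussian is a positive strict supersolution of
   - Laplacian w = lambda w, and the quotient of u by it is maximised. *)
Lemma dirichlet_le0 (lambda e : R) u : 0 <= a ->
  lambda < 2 * n%:R * a - 4 * a ^+ 2 ->
  dirichlet_eigenspace (unit_ball R n) lambda u ->
  forall x, unit_ball R n x -> e * u x <= 0.
Proof.
move=> a0 lam [uC2 uC uE uB] y Oy; rewrite leNgt; apply/negP => uy.
(* The quotient of e u by the Gaussian. The sign e will be 1 and -1, to bound u from both sides. *)
pose phi x : R := e * u x * expR (a * dotp x x).
have sub := @subset_closure _ (unit_ball R n).
have cexp : continuous (fun x : 'rV[R]_n => expR (a * dotp x x)).
  move=> x; apply: (@continuous_comp _ _ _ (fun x : 'rV[R]_n => a * dotp x x) expR).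
    have ca : continuous (cst a : 'rV[R]_n -> R) by exact: cst_continuous.
    by apply: (continuousM (ca x) (continuous_dotp x)).
  exact: continuous_expR.
have phiC : {within closure (unit_ball R n), continuous phi}.
  have ce : {within closure (unit_ball R n), continuous (cst e)}.
    by apply: continuous_subspaceT; exact: cst_continuous.
  have cexp' := continuous_subspaceT cexp.
  by move=> x; apply: (continuousM (continuousM (ce x) (uC x)) (cexp' _ x)).
have [|x0] := compact_EVT_max _ compact_closure_unit_ball phiC.
  by exists y; exact: sub.
rewrite inE => x0C x0max.
set M := phi x0 in x0max.
have M0 : 0 < M.
  apply: lt_le_trans (x0max y _); last by rewrite inE; exact: sub.
  by rewrite mulr_gt0 // expR_gt0.
have Ox0 : unit_ball R n x0.
  apply: contrapT => NO; move: M0; rewrite /M /phi uB ?mulr0 ?mul0r ?ltxx //.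
  by split=> // /interior_subset.
have w0 z : gaussian z = expR (- a * dotp z z).
  by rewrite /gaussian /radial mul1r.
have phiw z : e * u z = phi z * gaussian z.
  by rewrite w0 /phi -mulrA -expRD -mulrDl subrr mul0r expR0 mulr1.
have nearO : \forall z \near x0, unit_ball R n z.
  exact: (open_nbhs_nbhs (conj open_unit_ball Ox0)).
(* With w the Gaussian, e u - M w is nonpositive on the ball and vanishes at x0, so its pure second
   derivatives there are nonpositive. *)
have D i : e * partial i (partial i u) x0 - M * gaussian_dd i i x0 <= 0.
  apply: (second_derivative_at_max
    (fun z => e * u z - M * gaussian z)
    (fun z => e * partial i u z - M * gaussian_d i z) x0 (basis_vec i)).
  - near=> z.
    have Oz : unit_ball R n z by near: z.
    have [_ /(_ i) [du _] _] := uC2 z Oz.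
    apply: (is_deriveB (is_deriveZ e (derivableP du))
      (is_deriveZ M (is_derive_gaussian i z))).
  - have [_ _ /(_ i i) [ddu _]] := uC2 x0 Ox0.
    exact: (is_deriveB (is_deriveZ e (derivableP ddu))
      (is_deriveZ M (is_derive_gaussian_d i i x0))).
  - near=> z.
    have Oz : unit_ball R n z by near: z.
    rewrite !phiw -/M subrr subr_le0 ler_wpM2r ?w0 ?expR_ge0 //.
    by rewrite x0max // inE; exact: sub.
have : \sum_(i < n) (e * partial i (partial i u) x0 - M * gaussian_dd i i x0) <= 0.
  by apply: sumr_le0 => i _; exact: D.
rewrite sumrB -!mulr_sumr laplacian_gaussian -/(laplacian u x0).
have -> : laplacian u x0 = - (lambda * u x0) by rewrite -uE // opprK.
rewrite mulrN mulrCA phiw -/M w0.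
set E := expR _; set s := dotp x0 x0 => H.
have E0 : 0 < E by exact: expR_gt0.
(* The inequality summed over the axes says that this product is nonpositive, while s < 1 and the
   bound on lambda make it positive. *)
have : 0 < M * E * (2 * n%:R * a - 4 * a ^+ 2 * s - lambda).
  apply: mulr_gt0; first exact: mulr_gt0.
  rewrite subr_gt0; apply: lt_le_trans lam _.
  rewrite lerD2l lerN2 ler_piMr ?mulr_ge0 ?sqr_ge0 //.
  exact: ltW Ox0.
by move: H; set L := lambda; nra.
Unshelve. all: by end_near. Qed.

Lemma dirichlet_eq0 (lambda : R) u : 0 <= a ->
  lambda < 2 * n%:R * a - 4 * a ^+ 2 ->
  dirichlet_eigenspace (unit_ball R n) lambda u ->
  forall x, unit_ball R n x -> u x = 0.
Proof.
move=> a0 lam uD x Ox.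
have := dirichlet_le0 lambda 1 u a0 lam uD x Ox.
have := dirichlet_le0 lambda (-1) u a0 lam uD x Ox.
by rewrite mulN1r mul1r oppr_le0 => ? ?; apply/eqP; rewrite eq_le; apply/andP.
Qed.

End Gaussian.

End UnitBall.

(** * Neumann eigenfunctions of the ball *)

Section Neumann.
Context {R : realType} {n : nat}.
Implicit Types (x y v d : 'rV[R]_n) (A B : {set 'I_n}).

(** * Outward normals of the unit ball *)

Lemma dotpC x y : dotp x y = dotp y x.
Proof. by apply: eq_bigr => i _; rewrite mulrC. Qed.

Lemma dotpDl x y v : dotp (x + y) v = dotp x v + dotp y v.
Proof. by rewrite /dotp -big_split; apply: eq_bigr => i _; rewrite mxE mulrDl. Qed.

Lemma dotpZl (t : R) x v : dotp (t *: x) v = t * dotp x v.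
Proof. by rewrite /dotp mulr_sumr; apply: eq_bigr => i _; rewrite mxE mulrA. Qed.

Lemma dotpDr x y v : dotp v (x + y) = dotp v x + dotp v y.
Proof. by rewrite dotpC dotpDl !(dotpC v). Qed.

Lemma dotpZr (t : R) x v : dotp v (t *: x) = t * dotp v x.
Proof. by rewrite dotpC dotpZl dotpC. Qed.

Lemma dotp_le0 x : dotp x x <= 0 -> x = 0.
Proof.
move=> x0; have /eqP : dotp x x = 0 by apply/eqP; rewrite eq_le x0 dotp_ge0.
rewrite psumr_eq0 => [/allP H|i _]; last by rewrite -expr2 sqr_ge0.
apply/rowP => i; rewrite mxE; apply/eqP.
by have := H i (mem_index_enum i); rewrite /= mulf_eq0 orbb.
Qed.

(** A direction d that enters the ball has d.x < 0, so the half-space d.v < 0 lies in d.x < 0, which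
    forces v to be parallel to x. Parallelism suffices for the Neumann condition, which is linear in
    v. *)
Lemma outward_normal_unit_ball x v : dotp x x = 1 ->
  outward_normal (unit_ball R n) x v -> v = dotp x v *: x.
Proof.
move=> x1 [v1 Hin _]; set a := dotp x v.
have Hd d : dotp d v < 0 -> dotp d x < 0.
  move=> /Hin dO; near (0 : R)^'+ => t.
  have t0 : 0 < t by near: t; exact: nbhs_right_gt.
  have : dotp (x + t *: d) (x + t *: d) < 1 by near: t.
  rewrite dotpDl !dotpDr !dotpZl !dotpZr x1 (dotpC x d) => H.
  rewrite ltNge; apply/negP => dx.
  have : 0 <= t * dotp d x by rewrite mulr_ge0 // ltW.
  have : 0 <= t * (t * dotp d d) by rewrite !mulr_ge0 ?dotp_ge0 // ltW.
  by move: H; lra.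
have a1 : 1 <= a ^+ 2.
  rewrite leNgt; apply/negP => a1.
  (* If a ^ 2 < 1, this d has d.v = a ^ 2 - 1 < 0 but d.x = (1 - a) (1 - a ^ 2) > 0. *)
  have /Hd : dotp (x + - (a + (1 - a ^+ 2)) *: v) v < 0.
    by rewrite dotpDl dotpZl v1 -/a; lra.
  rewrite dotpDl dotpZl x1 (dotpC v) -/a => H.
  have aa : `|a| < 1 by rewrite -(@ltr_pXn2r _ 2) ?nnegrE // expr1n real_normK ?num_real.
  have := le_lt_trans (ler_norm a) aa.
  by nra.
have xav : x = a *: v.
  apply/eqP; rewrite -subr_eq0; apply/eqP/dotp_le0.
  rewrite -scaleNr dotpDl !dotpDr !dotpZl !dotpZr x1 v1 (dotpC v) -/a.
  by lra.
have a2 : a * a = 1 by move: x1; rewrite xav dotpZl dotpZr v1 mulr1.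
by rewrite [X in _ = _ *: X]xav scalerA a2 scale1r.
Unshelve. all: by end_near. Qed.

(** * Squarefree monomials, indexed by sets of coordinates *)

Definition monomial A : 'rV[R]_n -> R := fun x => \prod_(i in A) x 0 i.

Definition monomial_d A (i : 'I_n) : 'rV[R]_n -> R :=
  fun x => (i \in A)%:R * monomial (A :\ i) x.

Definition monomial_dd A (i j : 'I_n) : 'rV[R]_n -> R :=
  fun x => (i \in A)%:R * monomial_d (A :\ i) j x.

Lemma is_derive_monomial_notin A j x :
  j \notin A -> is_derive x (basis_vec j) (monomial A) 0.
Proof.
move=> jA; rewrite -[x]add0r -(scale0r (basis_vec j)); apply/is_derive_line.
rewrite (_ : (fun _ => _) = cst (monomial A x)); first exact: is_derive_cst.
apply/funext => h; apply: eq_bigr => i iA.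
rewrite 2!mxE basis_vecE; case: eqVneq => [ij|]; last by rewrite mulr0 add0r.
by rewrite -ij iA in jA.
Qed.

Lemma monomial_remove A j x : j \in A -> monomial A x = x 0 j * monomial (A :\ j) x.
Proof.
move=> jA; rewrite /monomial (bigD1 j) //=; congr (_ * _).
by apply: eq_bigl => i; rewrite in_setD1 andbC.
Qed.

Lemma is_derive_monomial A j x :
  is_derive x (basis_vec j) (monomial A) (monomial_d A j x).
Proof.
rewrite /monomial_d; have [jA|jA] := boolP (j \in A); last first.
  by rewrite mul0r; exact: is_derive_monomial_notin.
have -> : monomial A = (fun y : 'rV[R]_n => y 0 j) * monomial (A :\ j).
  by apply/funext => y; exact: monomial_remove.
have jAj : j \notin A :\ j by rewrite in_setD1 eqxx.
have H := is_deriveM (is_derive_coord x (basis_vec j) j)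
  (is_derive_monomial_notin (A :\ j) j x jAj).
apply: (is_derive_eq H).
by rewrite basis_vecE eqxx scaler0 add0r [LHS]mulr1 mul1r.
Qed.

Lemma is_derive_monomial_d A i j x :
  is_derive x (basis_vec j) (monomial_d A i) (monomial_dd A i j x).
Proof. exact: (is_deriveZ _ (is_derive_monomial (A :\ i) j x)). Qed.

Lemma continuous_monomial A : continuous (monomial A).
Proof.
have -> : monomial A = \prod_(i in A) (fun x : 'rV[R]_n => x 0 i).
  by apply/funext => x; rewrite fct_prodE.
elim/big_ind : _ => [|f g cf cg|i _] x.
- exact: cst_continuous.
- exact: (continuousM (cf x) (cg x)).
- exact: coord_continuous.
Qed.

Lemma continuous_monomial_d A i : continuous (monomial_d A i).
Proof.
have ca : continuous (cst (i \in A)%:R : 'rV[R]_n -> R) by exact: cst_continuous.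
by move=> x; apply: (continuousM (ca x) (continuous_monomial (A :\ i) x)).
Qed.

Lemma continuous_monomial_dd A i j : continuous (monomial_dd A i j).
Proof.
have ca : continuous (cst (i \in A)%:R : 'rV[R]_n -> R) by exact: cst_continuous.
by move=> x; apply: (continuousM (ca x) (continuous_monomial_d (A :\ i) j x)).
Qed.

(** Each variable has degree at most 1, so every pure second derivative vanishes. *)
Lemma monomial_harmonic A x : \sum_(i < n) monomial_dd A i i x = 0.
Proof.
apply: big1 => i _.
by rewrite /monomial_dd /monomial_d in_setD1 eqxx mul0r mulr0.
Qed.

Lemma monomial_euler A x : \sum_(i < n) x 0 i * monomial_d A i x = #|A|%:R * monomial A x.
Proof.
rewrite -sum1_card natr_sum mulr_suml [RHS]big_mkcond /=; apply: eq_bigr => i _.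
rewrite /monomial_d; case: ifPn => iA; last by rewrite mul0r mulr0.
by rewrite !mul1r -monomial_remove.
Qed.

(** A set A other than B but of the same size has an element outside B, which contributes a zero
    factor. Multiples of indicator vectors thus separate the monomials of one degree. *)
Lemma monomial_indicator A B (e : R) : #|A| = #|B| ->
  monomial A (\row_j (e * (j \in B)%:R)) = (A == B)%:R * e ^+ #|B|.
Proof.
move=> cAB; have [->|AB] := eqVneq A B.
  rewrite mul1r /monomial; under eq_bigr => j jB do rewrite mxE jB mulr1.
  by rewrite prodr_const.
have : ~~ (A \subset B).
  by apply: contra AB => sAB; rewrite eqEcard sAB cAB leqnn.
move=> /subsetPn[i iA iB].
by rewrite mul0r (monomial_remove _ _ _ iA) mxE (negbTE iB) mulr0 mul0r.
Qed.

(** * Neumann eigenfunctions built on squarefree monomials *)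

Section Eigenfunction.
Variables (k : nat) (mu : R).
Hypothesis k1 : (0 < k)%N.

(** For h harmonic and homogeneous of degree k, the Laplacian of h(x) F(mu |x|^2) is 4 mu h (z F'' +
    (n / 2 + k) F') at z = mu |x|^2: the factor h acts like 2 k extra dimensions. *)
Let c : R := n%:R / 2 + k%:R.

Let c1 : 1 <= c.
Proof. by rewrite /c -[leLHS]add0r lerD ?divr_ge0 ?ler1n. Qed.

Hypothesis mu_root :
  k%:R * bessel c mu + 2 * mu * (- (4 * c)^-1 * bessel (c + 1) mu) = 0.

Let f s : R := bessel c (mu * s).
Let f' s : R := mu * (- (4 * c)^-1 * bessel (c + 1) (mu * s)).
Let f'' s : R :=
  mu * (- (4 * c)^-1 * (mu * (- (4 * (c + 1))^-1 * bessel (c + 1 + 1) (mu * s)))).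

Let dscale b (s : R) : 1 <= b -> is_derive s 1 (fun s => bessel b (mu * s))
  (mu * (- (4 * b)^-1 * bessel (b + 1) (mu * s))).
Proof.
move=> b1.
have H1 : is_derive s 1 (fun s : R => mu * s) mu.
  by apply: (is_derive_eq (is_deriveZ mu (is_derive_id s 1))); rewrite [LHS]mulr1.
have H2 := is_derive_comp_line _ _ _ _ _ _ H1 (is_derive_bessel b (mu * s) b1).
by apply: (is_derive_eq H2); rewrite mulrC.
Qed.

Let df (s : R) : is_derive s 1 f (f' s).
Proof. exact: (dscale c s c1). Qed.

Let df' (s : R) : is_derive s 1 f' (f'' s).
Proof.
have c11 : 1 <= c + 1 by rewrite ler_wpDr.
by apply: (is_deriveZ mu (is_deriveZ (- (4 * c)^-1) (dscale (c + 1) s c11))).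
Qed.

Let cf'' : continuous f''.
Proof.
move=> s.
have c21 : 1 <= c + 1 + 1 by rewrite ler_wpDr // ler_wpDr.
have D : derivable (fun s => bessel (c + 1 + 1) (mu * s)) s 1.
  by have [] := dscale (c + 1 + 1) s c21.
have C : {for s, continuous (fun s => bessel (c + 1 + 1) (mu * s))}.
  by apply/differentiable_continuous/derivable1_diffP.
have E : f'' = (fun s => (mu * (- (4 * c)^-1 * (mu * - (4 * (c + 1))^-1))) *
    bessel (c + 1 + 1) (mu * s)).
  by apply/funext => t; rewrite /f''; ring.
have cK : continuous (cst (mu * (- (4 * c)^-1 * (mu * - (4 * (c + 1))^-1))) : R -> R).
  exact: cst_continuous.
by rewrite E; apply: (continuousM (cK s) C).
Qed.

Definition neumann_fun A : 'rV[R]_n -> R := radial (monomial A) f.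

Lemma neumann_fun_eigen A : #|A| = k ->
  neumann_eigenspace (unit_ball R n) mu (neumann_fun A).
Proof.
move=> cA.
have cfd i := continuous_radial_d (monomial A) (monomial_d A) f f' f''
  (continuous_monomial A) (continuous_monomial_d A) df df' i.
have dr i x := is_derive_radial_d (monomial A) (monomial_d A) f f'
  (is_derive_monomial A) df i x.
have cf : continuous f.
  by move=> s; apply/differentiable_continuous/derivable1_diffP; have [] := df s.
split.
- exact: (C2_on_radial (monomial A) (monomial_d A) (monomial_dd A) f f' f''
    (is_derive_monomial A) (is_derive_monomial_d A) (continuous_monomial A)
    (continuous_monomial_d A) (continuous_monomial_dd A) df df' cf'').
- exact: (continuous_subspaceT (continuous_radial _ _ (continuous_monomial A) cf)).
- move=> x _.
  rewrite (laplacian_radial (monomial A) (monomial_d A) (monomial_dd A) f f' f''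
    (is_derive_monomial A) (is_derive_monomial_d A) df df' x).
  rewrite monomial_harmonic monomial_euler cA /neumann_fun /radial /f /f' /f''.
  set s := dotp x x.
  (* The eigenvalue equation is [bessel_rec] at mu s; solving it for [bessel c] leaves an identity
     of rational functions. *)
  have := bessel_rec c (mu * s) c1.
  have c0 : c != 0 by rewrite gt_eqF // (lt_le_trans _ c1).
  have c10 : c + 1 != 0.
    by rewrite gt_eqF // addr_gt0 // (lt_le_trans _ c1).
  move: (bessel (c + 1 + 1) _) (bessel (c + 1) _) => J2 J1 rec.
  have -> : bessel c (mu * s) =
     J1 - mu * s * ((4 * (c + 1))^-1 * J2) / c.
    apply: (mulfI c0); rewrite -rec; field.
    by rewrite c0 c10.
  have -> : k%:R = c - n%:R / 2 by rewrite /c; ring.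
  move: c0 c10; set b := c; move=> c0 c10.
  field.
  by rewrite c0 c10.
- exists (radial_d (monomial A) (monomial_d A) f f'); split.
  + by move=> i; exact: (continuous_subspaceT (cfd i)).
  + by move=> i x _; rewrite (partialE _ _ dr).
  + move=> x v /boundary_unit_ball x1 /(outward_normal_unit_ball _ _ x1) ->.
    move: (dotp x v) => a.
    (* Up to the factor a, the normal derivative is the radial one; Euler's identity turns it into h
       (k F + 2 mu F') at mu, which is zero by the choice of mu. *)
    transitivity (a * (\sum_(i < n) x 0 i * monomial_d A i x * f 1 +
      dotp x x * (2 * monomial A x * f' 1))).
      rewrite /dotp mulr_suml -big_split mulr_sumr /=; apply: eq_bigr => i _.
      rewrite mxE /radial_d x1; ring.
    rewrite -mulr_suml monomial_euler cA x1 /f /f' !mulr1 mul1r.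
    have -> : k%:R * monomial A x * bessel c mu +
        2 * monomial A x * (mu * (- (4 * c)^-1 * bessel (c + 1) mu)) =
      monomial A x * (k%:R * bessel c mu + 2 * mu * (- (4 * c)^-1 * bessel (c + 1) mu)).
      by ring.
    by rewrite mu_root !mulr0.
Qed.

(** Independence is tested at e times the indicator of a k-set, a point of squared norm e ^ 2 k. It
    has to lie in the ball and off the zeros of the Bessel factor; that factor is 1 at the origin,
    so a small e will do. *)
Lemma bessel_small : exists2 e : R, 0 < e &
  e ^+ 2 * k%:R < 1 /\ 0 < bessel c (mu * (e ^+ 2 * k%:R)).
Proof.
have cg : continuous (fun e : R => bessel c (mu * (e ^+ 2 * k%:R))).
  move=> e; apply: (@continuous_comp _ _ _ (fun e : R => mu * (e ^+ 2 * k%:R))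
    (bessel c)); last exact: continuous_bessel.
  apply: cvgMr; apply: cvgMl; exact: exprn_continuous.
have : \forall e \near (0 : R), 0 < bessel c (mu * (e ^+ 2 * k%:R)).
  apply: (cvgr_gt _ (cg 0)).
  by rewrite expr0n mul0r mulr0 bessel0.
move=> /nbhs_ballP[r /= r0 Hr].
have k0 : 0 < k%:R :> R by rewrite ltr0n.
pose e := Num.min (r / 2) (2 * k%:R)^-1.
have e0 : 0 < e by rewrite lt_min divr_gt0 ?invr_gt0 ?mulr_gt0.
have er : e < r by apply: le_lt_trans (_ : r / 2 < r); [rewrite ge_min lexx|lra].
have ek : e * (2 * k%:R) <= 1.
  by rewrite -ler_pdivlMr ?mulr_gt0 // div1r ge_min lexx orbT.
have k1' : 1 <= k%:R :> R by rewrite ler1n.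
exists e => //; split; last by apply: Hr; rewrite /ball /= sub0r normrN gtr0_norm.
have e1 : e <= 1 by nra.
have : 0 < e * k%:R by rewrite mulr_gt0.
by rewrite expr2; nra.
Qed.

(** Evaluation at the test point of the set [enum_val i] kills every other term and leaves [a i]
    times a nonzero factor. *)
Lemma neumann_fun_indep (m := #|[set A : {set 'I_n} | #|A| == k]%SET|) :
  lin_indep_on (unit_ball R n)
    (fun i : 'I_m => neumann_fun (enum_val i)).
Proof.
move=> a H i; have [e e0 [e1 eb]] := bessel_small.
have cardE (j : 'I_m) : #|enum_val j| = k.
  by have := enum_valP j; rewrite inE => /eqP.
pose x : 'rV[R]_n := \row_j (e * (j \in enum_val i)%:R).
have xx : dotp x x = e ^+ 2 * k%:R.
  rewrite /dotp -(cardE i) -sum1_card natr_sum mulr_sumr [RHS]big_mkcond /=.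
  apply: eq_bigr => j _; rewrite !mxE.
  by case: (j \in _); rewrite ?mulr1 ?mulr0 ?expr2.
have := H x; rewrite /unit_ball /= xx => /(_ e1).
rewrite (bigD1 i) //= big1 => [|j ji].
  rewrite addr0 /neumann_fun /radial monomial_indicator // eqxx mul1r xx.
  move=> /eqP; rewrite !mulf_eq0 expf_eq0 (gt_eqF e0) andbF /=.
  by rewrite /f (gt_eqF eb) orbF => /eqP.
rewrite /neumann_fun /radial monomial_indicator ?cardE //.
by rewrite (inj_eq enum_val_inj) (negbTE ji) !mul0r mulr0.
Qed.

End Eigenfunction.

End Neumann.

(** * Counting eigenvalues *)

Section Counting.
Context {R : realType} {n : nat}.
Variables (Omega : set 'rV[R]_n) (E : R -> set ('rV[R]_n -> R)).
Implicit Types (s t L : R) (k m : nat).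

Lemma dim_on_ge (S : set ('rV[R]_n -> R)) m (f : 'I_m -> 'rV[R]_n -> R) :
  (forall i, S (f i)) -> lin_indep_on Omega f -> (m%:R%:E <= dim_on Omega S)%E.
Proof.
by move=> Sf indep; apply: ereal_sup_ubound; exists m => //; exists f.
Qed.

Lemma dim_on_ge0 (S : set ('rV[R]_n -> R)) : (0%:E <= dim_on Omega S)%E.
Proof.
have S0 (i : 'I_0) : S (cst 0) by case: i.
by apply: (dim_on_ge _ _ _ S0) => c _ i; case: i.
Qed.

Lemma dim_on_eq0 (S : set ('rV[R]_n -> R)) :
  (forall u, S u -> forall x, Omega x -> u x = 0) -> dim_on Omega S = 0%:E.
Proof.
move=> S0; apply/eqP; rewrite eq_le dim_on_ge0 andbT; apply: ge_ereal_sup.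
move=> _ [[|m] [f [Sf indep]] <-] //.
(* With at least one function, coefficients all equal to 1 give a relation, since the functions
   vanish on Omega. *)
have /(_ _ ord0)/eqP := indep (fun _ => 1); rewrite oner_eq0 => /(_ _)/negP[] //.
by move=> x Ox; apply: big1 => i _; rewrite (S0 _ (Sf i)) ?mulr0.
Qed.

Lemma eigen_seq_ge L k : (0 < k)%N ->
  (forall s u x, s < L -> E s u -> Omega x -> u x = 0) ->
  (L%:E <= eigen_seq Omega E k)%E.
Proof.
move=> k0 E0; apply: le_ereal_inf_tmp => _ [t /= kt <-].
rewrite lee_fin leNgt; apply/negP => tL; move: kt.
rewrite /eigen_count esum1 => [|s /= st].
  by rewrite lee_fin lern0 eqn0Ngt k0.
by apply: dim_on_eq0 => u su x; apply: E0 su; exact: le_lt_trans tL.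
Qed.

(** The count at t is a sum of nonnegative dimensions, among them that of the eigenspace of t
    itself. *)
Lemma eigen_seq_le t k m (f : 'I_m -> 'rV[R]_n -> R) : (k <= m)%N ->
  (forall i, E t (f i)) -> lin_indep_on Omega f ->
  (eigen_seq Omega E k <= t%:E)%E.
Proof.
move=> km Ef indep; apply: ereal_inf_lbound; exists t => //=.
apply: (@le_trans _ _ (m%:R%:E)); first by rewrite lee_fin ler_nat.
apply: (le_trans (dim_on_ge _ _ _ Ef indep)).
apply: esum_ge; exists [set t]; last by rewrite fsbig_set1.
by split; [exact: finite_set1|move=> _ -> /=].
Qed.

Lemma counting_ge m (S : set nat) :
  (forall k, (0 < k <= m)%N -> S k) -> (m%:R%:E <= counting S :> \bar R)%E.
Proof.
move=> HS; rewrite /counting; case: asboolP => [fS|_]; last exact: leey.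
rewrite lee_fin ler_nat -(size_iota 1 m); apply: uniq_leq_size.
  exact: iota_uniq.
move=> k; rewrite mem_iota add1n ltnS => /HS Sk.
by rewrite in_fset_set // inE.
Qed.

End Counting.

(** With K = 2 l, the inequality n - i >= n / 2 for i < K gives n ^ K <= 2 ^ K K! 'C(n, K). The
    threshold comes from 2 ^ K K! <= (2 K) ^ K = (16 l ^ 2) ^ l <= n ^ l. *)
Lemma leq_exp_bin (l n : nat) : (0 < l)%N -> (16 * l ^ 2 <= n)%N ->
  (n ^ l <= 'C(n, 2 * l))%N.
Proof.
move=> l0 ln; set K := (2 * l)%N.
have K0 : (0 < K)%N by rewrite muln_gt0.
have Kn : (2 * K <= n)%N by rewrite /K; nia.
have ffact_le m : (m`! <= m ^ m)%N.
  rewrite -ffactnn ffact_prod -[X in (m ^ X)%N]card_ord -prod_nat_const.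
  by apply: leq_prod => i _; exact: leq_subr.
have le_ffact : (n ^ K <= 2 ^ K * n ^_ K)%N.
  rewrite ffact_prod -[X in (_ ^ X <= _)%N]card_ord -[X in (_ <= _ ^ X * _)%N]card_ord.
  rewrite -!prod_nat_const -big_split /=; apply: leq_prod => i _.
  have := ltn_ord i; lia.
have nl : (2 ^ K * K`! <= n ^ l)%N.
  apply: (leq_trans (leq_mul (leqnn _) (ffact_le K))).
  rewrite -expnMn /K expnM leq_exp2r //; nia.
have f0 : (0 < 2 ^ K * K`!)%N by rewrite muln_gt0 expn_gt0 fact_gt0.
rewrite -(leq_pmul2r f0).
apply: (leq_trans (leq_mul (leqnn _) nl)).
rewrite -expnD addnn -mul2n -/K.
apply: (leq_trans le_ffact).
by rewrite -bin_ffact mulnCA mulnA.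
Qed.

Theorem theorem3 (R : realType) (l : nat) (hl : (0 < l)%N) :
  exists n0 : nat, (0 < n0)%N /\
    forall n : nat, (n0 <= n)%N ->
      (((n ^ l)%N%:R)%:E <= N_count (unit_ball R n))%E.
Proof.
exists (16 * l ^ 2)%N; split; first by rewrite muln_gt0 expn_gt0 hl.
move=> n n0n; pose k := (2 * l)%N.
have k0 : (0 < k)%N by rewrite muln_gt0.
have c1 : 1 <= n%:R / 2 + k%:R :> R.
  by rewrite -[leLHS]add0r lerD ?divr_ge0 ?ler1n.
have kR : 0 < k%:R :> R by rewrite ltr0n.
have [mu /andP[_ muL] muE] := neumann_root _ _ c1 kR.
have dirichlet : ((2 * (n%:R / 2 + k%:R) * k%:R : R)%:E <=
    dirichlet_eigenvalue (unit_ball R n) 1)%E.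
  apply: eigen_seq_ge => // s u x sL su.
  apply: (dirichlet_eq0 k%:R s u _ _ su) => //.
  apply: (lt_le_trans sL).
  (* The comparison k (n + 2 k) <= 2 n k - 4 k ^ 2 amounts to 6 k <= n, which holds as 12 l <= 16 l
     ^ 2. *)
  have nk : 6 * k%:R <= n%:R :> R by rewrite -natrM ler_nat /k; nia.
  by nra.
(* For 1 <= j <= n ^ l, the j-th Neumann eigenvalue is at most mu, which is at most k (n + 2 k),
   hence at most the first Dirichlet eigenvalue. *)
apply: counting_ge => j /andP[j0 jl]; split=> //.
apply: (le_trans _ dirichlet); apply: (@le_trans _ _ mu%:E); last by rewrite lee_fin.
apply: (eigen_seq_le _ _ _ _ _ _ _ _ (neumann_fun_indep k mu k0)).
  apply: (leq_trans jl); rewrite card_draws card_ord; exact: leq_exp_bin.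
move=> i; apply: neumann_fun_eigen => //.
by have := enum_valP i; rewrite inE => /eqP.
Qed.
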